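(* The following statements are true. (1) $\mathsf{C}(\beta\omega) = \mathsf{P}(\beta\omega) = \mathsf{WP}(\beta\omega) = \{\kappa\in\mathsf{CN} : \mathrm{cf}(\kappa)>\omega\}$. (2) $\{\kappa\in\mathsf{CN} : \mathrm{cf}(\kappa)>\omega\}\cup \{\kappa\in\mathsf{CN} : \kappa\geq 2^{\mathfrak{c}}\} \subseteq \mathsf{C}^{*}(\beta\omega)$. (3) $\mathsf{P}^{*}(\beta\omega) \subseteq \{\kappa\in\mathsf{CN} : \mathrm{cf}(\kappa)>\omega\}\cup \{\kappa\in\mathsf{CN} : \mathrm{cf}(\kappa)=\omega \text{ and } \kappa>\mathfrak{c}\}$. In particular, under the hypothesis $2^{\mathfrak{c}} = \mathfrak{c}^+$, (4) $\mathsf{C}^{*}(\beta\omega) = \mathsf{P}^{*}(\beta\omega) = \{\kappa\in\mathsf{CN} : \kappa\geq 2^{\mathfrak{c}}\}\cup \{\kappa\in\mathsf{CN} : \kappa< 2^{\mathfrak{c}}\text{ and } \mathrm{cf}(\kappa)>\omega\}$.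
   Context: $\beta\omega$ is the Stone-Čech compactification of the discrete space $\omega$ (the space of ultrafilters on $\omega$ with base $\{\{\mathcal U\in\beta\omega: A\in\mathcal U\}:A\subseteq\omega\}$); $\mathfrak c=|\mathbb R|$; $\mathsf{CN}$ is the class of infinite cardinals. For a topological space $X$, $\tau_X^+$ is the set of non-empty open subsets. A family of sets is centered if every non-empty finite subfamily has non-empty intersection, and a family in $\tau_X^+$ is linked if any two members intersect. An infinite cardinal $\kappa$ is a caliber (resp. precaliber; weak precaliber) for $X$ if for every indexed family $\{U_\alpha:\alpha<\kappa\}\subseteq\tau_X^+$ (repetitions allowed) there is $J\subseteq\kappa$ with $|J|=\kappa$ such that $\bigcap_{\alpha\in J}U_\alpha\ne\emptyset$ (resp. $\{U_\alpha:\alpha\in J\}$ is centered; is linked). It is a caliber* (resp. precaliber* ) for $X$ if for every set $\mathcal U\subseteq\tau_X^+$ with $|\mathcal U|=\kappa$ there is $\mathcal V\subseteq\mathcal U$ with $|\mathcal V|=\kappa$ and $\bigcap\mathcal V\neq\emptyset$ (resp. $\mathcal V$ centered). $\mathsf C(X),\mathsf P(X),\mathsf{WP}(X)$ are the classes of calibers, precalibers, weak precalibers of $X$; $\mathsf C^*(X),\mathsf P^*(X)$ are the classes of calibers* and precalibers* of $X$. *)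

(* Defs.v *)
From HB Require Import structures.
From mathcomp Require Import all_boot.
From mathcomp Require Import boolp contra wochoice classical_sets functions.
From mathcomp Require Import cardinality filter topology_structure.
From Stdlib Require Rdefinitions.

Set Implicit Arguments.
Unset Strict Implicit.
Unset Printing Implicit Defensive.

Local Open Scope classical_set_scope.
Local Open Scope card_scope.

(* A cardinal is an initial ordinal: a well-ordered type none of whose proper
   initial segments is as large as the whole type.  The same cardinal number has
   many such representatives, so equality of cardinal numbers is [=c] below. *)
Record cardinal := Cardinal {
  carrier :> Type;
  cle : rel carrier;
  cle_wo : well_order cle;
  cle_initial : forall a, ~~ ([set: carrier] #<= [set x | ~~ cle a x])
}.

Notation "k <=c l" := (is_true ([set: carrier k] #<= [set: carrier l]))
  (at level 70, no associativity).
Notation "k =c l" := (is_true ([set: carrier k] #= [set: carrier l]))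
  (at level 70, no associativity).
Notation "k <c l" := (k <=c l /\ ~ l <=c k)
  (at level 70, no associativity).

Lemma card_of_subproof (T : Type) : exists k : cardinal, [set: k] #= [set: T].
Proof.
have [R Rwo] := well_ordering_principle {classic T}.
pose seg (a : T) : set T := [set x | ~~ R a x].
have [H|/existsNP[a0 Ha0]] := pselect (forall a, ~~ ([set: T] #<= seg a)).
  by exists (@Cardinal T R Rwo H); exact: card_eqxx.
move/negP: Ha0; rewrite negbK => Ha0.
have [|a [[Aa amin] _]] := Rwo [pred a : {classic T} | [set: T] #<= seg a].
  by exists a0.
have {}Aa : [set: T] #<= seg a := Aa.
have Rxx (x : T) : R x x by apply: (wo_chain_reflexive (withinW Rwo)).
pose K := {x : T | x \in seg a}.
have KT : [set: K] #= [set: T].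
  by rewrite (card_eql (card_setT _)) card_eq_le Aa andbT; exact: card_leT.
pose RK : rel K := fun x y => R (sval x) (sval y).
have RKwo : well_order RK.
  move=> A [x Ax].
  have [|m [[/asboolP[m' [Am' mm']] mmin] muniq]] :=
      Rwo [pred x : {classic T} | `[< exists y : K, y \in A /\ sval y = x >]].
    by exists (sval x); apply/asboolP; exists x.
  have mK (y : K) : y \in A -> R m (sval y).
    by move=> Ay; apply: mmin; apply/asboolP; exists y.
  exists m'; split; first by split=> // y /mK; rewrite /RK mm'.
  move=> y [Ay ymin]; apply: val_inj; apply: etrans mm' _; apply: muniq; split.
    by apply/asboolP; exists y.
  by move=> _ /asboolP[z [Az <-]]; exact: ymin.
suff Kini b : ~~ ([set: K] #<= [set x | ~~ RK b x]).
  by exists (Cardinal RKwo Kini).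
apply/negP => Kb; have /set_mem/negP := svalP b; apply; apply: amin.
apply: card_le_trans (_ : [set: K] #<= _).
  by move: KT; rewrite card_eq_sym card_eq_le => /andP[].
apply: (card_le_trans Kb).
rewrite -(card_le_eql (@inj_card_eq _ _ _ (sval : K -> T) _)).
  by apply: subset_card_le => _ [y ? <-].
by move=> x y _ _; exact: val_inj.
Qed.

Definition card_of (T : Type) : cardinal := sval (cid (card_of_subproof T)).

Lemma card_ofP (T : Type) : [set: card_of T] #= [set: T].
Proof. exact: svalP (cid (card_of_subproof T)). Qed.

Lemma cmin_subproof (F : set cardinal) :
  exists k, F !=set0 -> F k /\ forall l, F l -> k <=c l.
Proof.
have [[k0 Fk0]|] := pselect (F !=set0); last by exists (card_of unit).
pose I := {k : cardinal | F k}.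
pose P := forall i : I, sval i.
pose ok : set (set P) := [set Z | forall (i : I) (f g : P), Z f -> Z g ->
  f i = g i -> f = g].
have [|Z [Zok Zmax]] := @Zorn_bigcup P ok.
  move=> C Cok Ctot i f g [Z1 C1 Z1f] [Z2 C2 Z2g] fg.
  have [s12|s21] := Ctot _ _ C1 C2.
    by apply: (Cok _ C2 i) => //; exact: s12.
  by apply: (Cok _ C1 i) => //; exact: s21.
have [i isurj] : exists i : I, forall x : sval i, exists2 f, Z f & f i = x.
  apply: contrapT => /forallNP Hn.
  have /all_sig[f0 f0P] : forall i : I, {x : sval i | forall f, Z f -> f i <> x}.
    move=> i; apply: cid; have /existsNP[x xP] := Hn i.
    by exists x => f Zf fx; apply: xP; exists f.
  apply: (Zmax (f0 |` Z)).
    split=> [f Zf|sub]; first by right.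
    by apply: (f0P (exist _ k0 Fk0) f0) => //; apply: sub; left.
  move=> i f g [->|Zf] [->|Zg] // fg; first by have := f0P i _ Zg; rewrite -fg.
    by have := f0P i _ Zf; rewrite fg.
  exact: (Zok i).
exists (sval i) => _; split; first exact: svalP i.
move=> l Fl; pose j : I := exist _ l Fl.
have /all_sig2[h hZ hi] : forall x : sval i, {f | Z f & f i = x}.
  by move=> x; apply: cid2; exact: isurj.
have hinj : injective (fun x : sval i => h x j).
  by move=> x y /(Zok j _ _ (hZ x) (hZ y)) hxy; rewrite -(hi x) hxy hi.
rewrite -(card_le_eql (@inj_card_eq _ _ setT _ (in2W hinj))).
exact: card_leT.
Qed.

(* A least member of F, unique up to [=c], when F is non-empty. *)
Definition cmin (F : set cardinal) : cardinal := sval (cid (cmin_subproof F)).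

Lemma cminP (F : set cardinal) :
  F !=set0 -> F (cmin F) /\ forall l, F l -> cmin F <=c l.
Proof. exact: svalP (cid (cmin_subproof F)). Qed.

Definition omega : cardinal := card_of nat.
Definition continuum : cardinal := card_of Rdefinitions.R.
Definition cpow2 (k : cardinal) : cardinal := card_of (k -> bool).
Definition csucc (k : cardinal) : cardinal := cmin [set l | k <c l].

(* Non-strict, so that finite successors have cofinality 1; for infinite [k] the
   order [cle] has no greatest element and this means unbounded. *)
Definition cofinal (k : cardinal) (S : set k) : Prop :=
  forall x, exists2 y, S y & cle x y.

Definition cf (k : cardinal) : cardinal :=
  cmin [set l | exists2 S : set k, cofinal S & S #= [set: l]].

Lemma cfP (k : cardinal) :
  (exists2 S : set k, cofinal S & S #= [set: cf k]) /\
  (forall S : set k, cofinal S -> [set: cf k] #<= S).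
Proof.
have H (S : set k) : S #= [set: card_of {x : k | x \in S}].
  rewrite card_eq_sym (card_eql (card_ofP _)); exact: card_setT.
have [|ex lb] := @cminP [set l | exists2 S : set k, cofinal S & S #= [set: l]].
  exists (card_of {x : k | x \in [set: k]}), setT => // x; exists x => //.
  exact: (@wo_chain_reflexive {classic k} _ _ (withinW (@cle_wo k))).
split=> // S Sc; rewrite (card_le_eqr (H S)).
by apply: lb; exists S.
Qed.

Lemma csuccP (k : cardinal) :
  k <c csucc k /\ forall l, k <c l -> csucc k <=c l.
Proof.
apply: cminP; exists (cpow2 k) => /=; rewrite /cpow2.
set Q := card_of _; have QE : [set: Q] #= [set: k -> bool] by exact: card_ofP.
rewrite (card_le_eqr QE) (card_le_eql QE); split.
  have inj : injective (fun x : k => fun y : k => `[< x = y >]).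
    by move=> x y /(congr1 (@^~ y)) e; apply/asboolP; rewrite e; apply/asboolP.
  rewrite -(card_le_eql (@inj_card_eq _ _ setT _ (in2W inj))).
  exact: card_leT.
move=> /card_leP[g]; have /= inj := @inj _ _ _ g.
pose u (A : k -> bool) : k := val (g (SigSub (mem_set (I : [set: k -> bool] A)))).
have uinj : injective u.
  move=> A B /val_inj e.
  by have /(congr1 val) := inj _ _ (mem_set I) (mem_set I) e.
pose D (x : k) := `[< exists2 A, u A = x & ~~ A x >].
have nD : ~ D (u D).
  move=> /[dup] DuD /asboolP[A /uinj ->]; exact/negP/negPn.
by apply: (nD); apply/asboolP; exists D => //; exact/negP.
Qed.

Section Calibers.
Variable X : topologicalType.

Definition tau_plus : set (set X) := [set U | open U /\ U !=set0].

Definition centered (V : set (set X)) : Prop :=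
  forall F, F `<=` V -> finite_set F -> F !=set0 -> \bigcap_(A in F) A !=set0.

Definition linked (V : set (set X)) : Prop :=
  forall A B, V A -> V B -> A `&` B !=set0.

End Calibers.

Definition CN : set cardinal := [set k | infinite_set [set: k]].

Definition calibers (X : topologicalType) : set cardinal :=
  [set k | CN k /\
    forall U : k -> set X, (forall a, tau_plus (U a)) ->
    exists J : set k, J #= [set: k] /\ \bigcap_(a in J) U a !=set0].

Definition precalibers (X : topologicalType) : set cardinal :=
  [set k | CN k /\
    forall U : k -> set X, (forall a, tau_plus (U a)) ->
    exists J : set k, J #= [set: k] /\ centered (U @` J)].

Definition weak_precalibers (X : topologicalType) : set cardinal :=
  [set k | CN k /\
    forall U : k -> set X, (forall a, tau_plus (U a)) ->
    exists J : set k, J #= [set: k] /\ linked (U @` J)].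

Definition calibers_star (X : topologicalType) : set cardinal :=
  [set k | CN k /\
    forall U : set (set X), U `<=` @tau_plus X -> U #= [set: k] ->
    exists V, [/\ V `<=` U, V #= [set: k] & \bigcap_(A in V) A !=set0]].

Definition precalibers_star (X : topologicalType) : set cardinal :=
  [set k | CN k /\
    forall U : set (set X), U `<=` @tau_plus X -> U #= [set: k] ->
    exists V, [/\ V `<=` U, V #= [set: k] & centered V]].

(* Ultrafilters on nat (principal ones included), with the topology generated
   by the sets [beta_base A] below. *)
Record beta_omega := BetaOmega {
  ultra_sets :> set_system nat;
  ultra_setsP : UltraFilter ultra_sets
}.

HB.instance Definition _ := gen_eqMixin beta_omega.
HB.instance Definition _ := gen_choiceMixin beta_omega.

Lemma ultra_filter (u : beta_omega) : Filter u.
Proof. by have [[]] := ultra_setsP u. Qed.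

Definition beta_base (A : set nat) : set beta_omega :=
  [set u : beta_omega | ultra_sets u A].

Lemma beta_base_cover : \bigcup_(A in [set: set nat]) beta_base A = setT.
Proof.
apply/seteqP; split=> // u _; exists setT => //.
exact: (@filterT _ _ (ultra_filter u)).
Qed.

Lemma beta_base_join (A B : set nat) (u : beta_omega) :
  [set: set nat] A -> [set: set nat] B -> beta_base A u -> beta_base B u ->
  exists C, [/\ [set: set nat] C, beta_base C u &
                beta_base C `<=` beta_base A `&` beta_base B].
Proof.
move=> _ _ Au Bu; exists (A `&` B); split=> //.
  exact: (@filterI _ _ (ultra_filter u)).
move=> v vAB.
by split; apply: (@filterS _ _ (ultra_filter v) _ _ _ vAB) => x [].
Qed.

HB.instance Definition _ :=
  isBaseTopological.Build beta_omega beta_base_cover beta_base_join.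

Lemma beta_openE (O : set beta_omega) :
  open O <-> exists2 D, D `<=` [set: set nat] & \bigcup_(A in D) beta_base A = O.
Proof. by []. Qed.

(* Main.v *)
Require Import Defs.
From mathcomp Require Import all_boot all_order all_algebra.
From mathcomp Require Import boolp wochoice classical_sets functions.
From mathcomp Require Import cardinality filter topology_structure.
From mathcomp Require Import reals Rstruct lra.
Import Order.TTheory GRing.Theory Num.Theory.

Local Open Scope classical_set_scope.
Local Open Scope card_scope.

(** Everything rests on one pigeonhole property.  Call a set countably
    indecomposable if, however it is cut into countably many pieces, one piece
    is as large as the whole.

    The principal ultrafilters form a countable dense subset of beta omega, so
    sorting open sets by a principal ultrafilter they contain cuts any family
    of them into countably many pieces, each with a common point.  Hence every
    indecomposable cardinal is a caliber, and every indecomposable set of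
    non-empty open sets has an equipotent subset with a common point
    ([separable_indecomposable_caliber],
    [separable_indecomposable_common_point]).

    An infinite cardinal is indecomposable exactly when its cofinality is
    uncountable ([cf_uncountable_indecomposable] and its converse).  The
    cardinal [2^c] is indecomposable too, by a diagonal argument in the style
    of Konig ([power_indecomposable]).  As beta omega has at most [2^c] open
    sets, a set of open sets of size at least [2^c] has exactly that size,
    which settles the star calibers above [2^c].

    Conversely, a decomposition [d : k -> nat] into small pieces refutes even
    the weakest property, linkedness: the basic clopen sets of the singletons
    [d a] meet only inside a piece.  For the star notions the open sets have to
    be distinct, which is possible as long as [k] is at most the continuum: cut
    omega into infinitely many infinite columns and use distinct subsets of
    column [d a] ([precalibers_star_cf_uncountable]).  Finally, if [2^c] is the
    successor of [c], no cardinal lies strictly between the upper and the lower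
    bound obtained for the star classes, so these coincide. *)

(** * Comparing cardinalities *)

Lemma injective_on_card_le {T U : Type} (A : set T) (B : set U) (f : T -> U) :
  (forall x, A x -> B (f x)) ->
  (forall x y, A x -> A y -> f x = f y -> x = y) -> A #<= B.
Proof.
move=> fAB finj.
have E : f @` A #= A.
  by apply: inj_card_eq => x y /set_mem Ax /set_mem Ay; exact: finj.
rewrite -(card_le_eql E); apply: subset_card_le.
by move=> _ [x Ax <-]; exact: fAB.
Qed.

Lemma injective_card_le {T U : Type} (f : T -> U) :
  injective f -> [set: T] #<= [set: U].
Proof.
by move=> finj; apply: (injective_on_card_le _ _ f) => // x y _ _; exact: finj.
Qed.

Lemma card_le_injective_on {T U : Type} (A : set T) (B : set U) :
  B !=set0 -> A #<= B ->
  exists2 f : T -> U, (forall x, A x -> B (f x)) &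
                      (forall x y, A x -> A y -> f x = f y -> x = y).
Proof.
move=> [b0 Bb0] /card_leP[g].
have /= ginj := @inj _ _ _ g.
pose f x := if pselect (A x) is left Ax then val (g (SigSub (mem_set Ax))) else b0.
exists f => [x Ax|x y Ax Ay]; rewrite /f.
  by case: pselect => // ?; apply: set_mem; exact: valP.
case: pselect => // Ax'; case: pselect => // Ay' /val_inj e.
by have /(congr1 val) := ginj _ _ (mem_set I) (mem_set I) e.
Qed.

(** Well-orders need not be compared here: the minimum of the pair [k, l] is one
    of the two. *)
Lemma cardinal_le_total (k l : cardinal) : k <=c l \/ l <=c k.
Proof.
have [|[e|e] least] := @cminP [set m | m = k \/ m = l]; first by exists k; left.
  by left; have := least l (or_intror erefl); rewrite e.
by right; have := least k (or_introl erefl); rewrite e.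
Qed.

(** By Zorn, a maximal family of pairwise disjoint injective sequences covers
    all of [T] but a finite remainder, so that [T] is the product of the family
    with nat up to a countable set, and nat absorbs a further factor nat. *)
Lemma infinite_prod_nat_card_le (T : Type) :
  infinite_set [set: T] -> [set: T * nat] #<= [set: T].
Proof.
move=> Tinf.
pose ok := [set Z : set (nat -> T) | (forall f, Z f -> injective f) /\
  forall f g i j, Z f -> Z g -> f i = g j -> f = g].
have [|Z [[Zinj Zdisj] Zmax]] := @Zorn_bigcup _ ok.
  move=> C Cok Ctot; split=> [f [Y CY Yf]|f g i j [Y1 C1 Y1f] [Y2 C2 Y2g] fg].
    exact: (Cok _ CY).1.
  have [s12|s21] := Ctot _ _ C1 C2.
    by apply: ((Cok _ C2).2 f g i j) => //; exact: s12.
  by apply: ((Cok _ C1).2 f g i j) => //; exact: s21.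
pose rest := [set t | forall f i, Z f -> f i <> t].
have restfin : finite_set rest.
  apply: contrapT => /infiniteP natR.
  have [r0 Rr0] : rest !=set0.
    apply/set0P/negP => /eqP R0; move: natR; rewrite R0.
    by move=> /card_le0P /seteqP[/(_ 0 I)].
  have [h hR hinj] := card_le_injective_on _ _ (ex_intro _ r0 Rr0) natR.
  apply: (Zmax (h |` Z)).
    split=> [f Zf|sub]; first by right.
    by apply: (hR 0 I h 0) => //; apply: sub; left.
  split=> [f [->|Zf]|f g i j [->|Zf] [->|Zg] //].
  - by move=> x y; exact: hinj.
  - exact: Zinj.
  - by move=> e; case: (hR i I g j Zg).
  - by move=> e; case: (hR j I f i Zf).
  - exact: Zdisj.
have [f0 Zf0] : Z !=set0.
  apply/set0P/negP => /eqP Z0; apply: Tinf.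
  by apply: sub_finite_set restfin => t _ f i; rewrite Z0.
have /countable_injP[e einj] := finite_set_countable restfin.
(* A point of [T] is located by a sequence and an index in it; points of the
   remainder borrow the sequence [f0] and are told apart by the tag [inr]. *)
pose codes t (p : (nat -> T) * (nat + nat)) := Z p.1 /\
  match p.2 with inl i => p.1 i = t | inr i => rest t /\ e t = i end.
have /choice[c cP] : forall t, exists p, codes t p.
  move=> t; have [Rt|] := pselect (rest t); first by exists (f0, inr (e t)).
  move=> /existsNP[f /existsNP[i /not_implyP[Zf /contrapT fit]]].
  by exists (f, inl i).
have cinj t u : c t = c u -> t = u.
  move=> ctu; have [_] := cP t; have [_] := cP u; rewrite ctu.
  case: (c u).2 => i; first by move=> -> ->.
  by move=> [Ru <-] [Rt]; apply: einj; exact: mem_set.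
apply: (injective_card_le (fun x => (c x.1).1 (pickle ((c x.1).2, x.2)))).
move=> [t n] [u m] /= E; have [Zt _] := cP t; have [Zu _] := cP u.
have e1 := Zdisj _ _ _ _ Zt Zu E; move: E; rewrite e1 => /(Zinj _ Zu).
move=> /(pcan_inj pickleK)[e2 ->]; congr pair; apply: cinj.
by rewrite [c t]surjective_pairing e1 e2 -surjective_pairing.
Qed.

Lemma infinite_setX_nat_card_le {T : Type} (A : set T) :
  infinite_set A -> A `*` [set: nat] #<= A.
Proof.
move=> Ainf; have Sinf : infinite_set [set: A].
  move=> /(card_le_finite _) fin; apply: Ainf; apply: fin.
  by rewrite (card_le_eqr (card_setT A)).
have le := infinite_prod_nat_card_le _ Sinf.
rewrite -(card_le_eqr (card_setT A)); apply: card_le_trans le.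
have [a Aa] := infinite_setN0 Ainf.
have ASl : A #<= [set: A] by rewrite (card_le_eqr (card_setT A)).
have AN0 : [set: A] !=set0 by exists (SigSub (mem_set Aa)).
have [f _ finj] := card_le_injective_on _ _ AN0 ASl.
apply: (injective_on_card_le _ _ (fun p => (f p.1, p.2))) => //.
by move=> [x n] [y m] /= [Ax _] [Ay _] [/(finj x y Ax Ay) -> ->].
Qed.

(** * Initial ordinals and cofinality *)

Section InitialOrdinal.
Variable k : cardinal.

Definition clt (x y : k) : Prop := ~~ cle y x.
Definition below (a : k) : set k := [set x | clt x a].

Lemma cle_refl (x : k) : cle x x.
Proof. exact: (@wo_chain_reflexive {classic k} _ _ (withinW (@cle_wo k))). Qed.

Lemma cle_total (x y : k) : cle x y || cle y x.
Proof. exact: (@wo_chainW {classic k} _ _ (withinW (@cle_wo k))). Qed.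

Lemma cle_anti (x y : k) : cle x y -> cle y x -> x = y.
Proof.
move=> xy yx; apply: (@wo_chain_antisymmetric {classic k} _ _ (withinW (@cle_wo k))) => //.
by rewrite xy.
Qed.

Lemma clt_wf : well_founded clt.
Proof.
move=> x; apply: contrapT => nx.
have [|m [[/asboolP nm mmin] _]] := @cle_wo k [pred y | `[< ~ Acc clt y >]].
  by exists x; apply/asboolP.
apply: nm; constructor=> y ym; apply: contrapT => ny.
by move: ym; rewrite /clt mmin //; exact/asboolP.
Qed.

Lemma cle_trans (x y z : k) : cle x y -> cle y z -> cle x z.
Proof.
move=> xy yz.
have [|m [[+ mmin] _]] := @cle_wo k [pred t | `[< t = x \/ t = y \/ t = z >]].
  by exists x; apply/asboolP; left.
have mm t : t = x \/ t = y \/ t = z -> cle m t by move=> ?; exact/mmin/asboolP.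
move=> /asboolP[e|[e|e]]; rewrite e in mm; first by apply: mm; tauto.
  by rewrite (cle_anti x y xy (mm x _)) //; tauto.
have zy : y = z by apply: cle_anti => //; apply: mm; tauto.
by rewrite -zy.
Qed.

(** By transfinite recursion, choose at each [x] a point of [B] different from
    those chosen before [x]; one is left, since [B] does not embed into the
    proper segment below [x]. *)
Lemma card_le_of_segments {T : Type} (B : set T) :
  (forall a, ~ (B #<= below a)) -> [set: k] #<= B.
Proof.
move=> Bbig.
have [[a]|k0] := pselect (exists a : k, True); last first.
  suff -> : [set: k] = set0 by exact: card_ge0.
  by apply/seteqP; split=> // x _; apply: k0; exists x.
move=> _; have [t0 Bt0] : B !=set0.
  by apply/set0P/negP => /eqP B0; apply: (Bbig a); rewrite B0; exact: card_ge0.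
pose fresh (x : k) (rec : forall y, clt y x -> T) t :=
  B t /\ forall y yx, rec y yx <> t.
pose step x rec :=
  if pselect (exists t, fresh x rec t) is left ex then sval (cid ex) else t0.
pose g := Fix clt_wf (fun=> T) step.
have gE x : g x = step x (fun y _ => g y).
  apply: (Fix_eq clt_wf (fun=> T) step) => y f1 f2 f12; congr step.
  apply: functional_extensionality_dep => z.
  exact: functional_extensionality_dep.
have gfresh x : B (g x) /\ forall y, clt y x -> g y <> g x.
  rewrite gE /step; case: pselect => [ex|/forallNP none]; first exact: svalP (cid ex).
  case: (Bbig x); apply: (card_le_trans _ (card_image_le g _)).
  apply: subset_card_le => t Bt; apply: contrapT => nt.
  by apply: (none t); split=> // y yx e; apply: nt; exists y.
apply: (injective_on_card_le _ _ g) => [x _|x y _ _ gxy].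
  exact: (gfresh x).1.
have [xy|nxy] := boolP (cle x y); last by case: ((gfresh x).2 y nxy).
have [yx|nyx] := boolP (cle y x); first exact: cle_anti.
by case: ((gfresh y).2 x nyx).
Qed.

Lemma below_prod_nat_small (a : k) :
  infinite_set (below a) -> ~ ([set: k] #<= below a `*` [set: nat]).
Proof.
move=> ainf le; have /negP := @cle_initial k a; apply.
exact: (card_le_trans le (infinite_setX_nat_card_le _ ainf)).
Qed.

Hypothesis kinf : CN k.

(** Adjoining the point [a] to an infinite proper segment does not change its
    cardinality, and a finite one stays finite. *)
Lemma cle_segment_small (a : k) : ~ ([set: k] #<= [set x | cle x a]).
Proof.
have segE : [set x | cle x a] = a |` below a.
  apply/seteqP; split=> [x xa|x [->|xa]] /=; last 2 first.
  - exact: cle_refl.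
  - by move: xa; rewrite /below /clt /=; have /orP[->|->] := cle_total a x.
  have [ax|nax] := boolP (cle a x); first by left; exact: cle_anti.
  by right.
have [afin|ainf] := pselect (finite_set (below a)).
  move=> /card_le_finite le; apply: kinf; apply: le; rewrite segE.
  by rewrite finite_setU.
move=> le; apply: (below_prod_nat_small a ainf); apply: (card_le_trans le).
have [b ba] := infinite_setN0 ainf.
pose f x := if pselect (clt x a) then (x, 0) else (b, 1).
apply: (injective_on_card_le _ _ f) => [x|x y]; rewrite segE /f /=.
  by case: pselect.
case: pselect => xa hx; case: pselect => ya hy; do ?by case.
by move=> _; case: hx => [->|/xa//]; case: hy => [->|/ya].
Qed.

(** A finite cofinal set would have a greatest element, whose closed segment
    would be all of [k]. *)
Lemma cofinal_infinite (S : set k) : cofinal S -> infinite_set S.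
Proof.
move=> Scof Sfin; have [a _] := infinite_setN0 kinf.
have [m mS] : exists m, forall y, S y -> cle y m.
  have /(@finite_seqP {classic k})[s ->] := Sfin.
  elim: s => [|y s [m ms]] /=; first by exists a.
  have [my|ym] := orP (cle_total m y).
    exists y => z; rewrite in_cons => /orP[/eqP->|/ms zm]; first exact: cle_refl.
    exact: cle_trans zm my.
  by exists m => z; rewrite in_cons => /orP[/eqP->//|/ms].
apply: (cle_segment_small m); apply: subset_card_le => x _ /=.
by have [y /mS ym xy] := Scof x; exact: cle_trans xy ym.
Qed.

Lemma cf_infinite : CN (cf k).
Proof.
have [[S Scof ScfE] _] := cfP k.
by move: (cofinal_infinite S Scof); rewrite /CN /= (eq_finite_set ScfE).
Qed.

End InitialOrdinal.

(** * Countable indecomposability *)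

Definition countably_indecomposable {T : Type} (A : set T) : Prop :=
  forall d : T -> nat, exists n, A #<= A `&` d @^-1` [set n].

Lemma countably_indecomposable_eq {T U : Type} (A : set T) (B : set U) :
  A #= B -> countably_indecomposable A -> countably_indecomposable B.
Proof.
rewrite card_eq_le => /andP[AB BA] indec d.
have [B0|/set0P B0] := eqVneq B set0.
  by exists 0; rewrite B0 card_ge0.
have [f fAB finj] := card_le_injective_on _ _ B0 AB.
have [n le] := indec (d \o f); exists n.
apply: (card_le_trans BA); apply: (card_le_trans le).
apply: (injective_on_card_le _ _ f) => [x [Ax dx]|x y [Ax _] [Ay _]].
  by split=> //; exact: fAB.
exact: finj.
Qed.

(** If all pieces are small, each embeds into some proper segment, below [a n]
    say.  Either the [a n] are cofinal, or some [x] bounds them all and then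
    [k] embeds into the product of the segment below [x] with nat, which is
    small by [below_prod_nat_small] unless [k] is countable. *)
Lemma cf_uncountable_indecomposable (k : cardinal) :
  CN k -> omega <c cf k -> countably_indecomposable [set: k].
Proof.
move=> kinf [_ cfN] d; apply: contrapT => /forallNP small; apply: cfN.
have [_ cf_least] := cfP k.
rewrite (card_le_eqr (card_ofP nat)).
have /choice[a aP] : forall n, exists a, d @^-1` [set n] #<= below k a.
  move=> n; apply: contrapT => /forallNP nle; apply: (small n).
  by rewrite setTI; exact: card_le_of_segments.
have [acof|/existsNP[x /forall2NP xP]] := pselect (cofinal (range a)).
  by apply: (card_le_trans (cf_least _ acof)); exact: card_image_le.
have le : [set: k] #<= below k x `*` [set: nat].
  (* As [x] lies above every [a n], all pieces embed into the segment of [x]. *)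
  have dx n : d @^-1` [set n] #<= below k x.
    apply: (card_le_trans (aP n)); apply: subset_card_le => y ya.
    have [[]|xa] := xP (a n); first by exists n.
    apply/negP => xy; case: xa; apply: (cle_trans k x y _ xy).
    by have /orP[an|//] := cle_total k (a n) y; case/negP: ya.
  have /choice[f fP] : forall n, exists f : k -> k,
      (forall y, d y = n -> below k x (f y)) /\
      (forall y z, d y = n -> d z = n -> f y = f z -> y = z).
    move=> n; have [x0|/set0P xN0] := eqVneq (below k x) set0.
      exists id; split=> // y dy; move: (dx n); rewrite x0 => /card_le0P E.
      by rewrite -E.
    by have [f] := card_le_injective_on _ _ xN0 (dx n); exists f.
  apply: (injective_on_card_le _ _ (fun y => (f (d y) y, d y))).
    by move=> y _; split=> //; exact: (fP (d y)).1.
  by move=> y z _ _ [+ dyz]; rewrite dyz; exact: (fP (d z)).2.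
have [xfin|xinf] := pselect (finite_set (below k x)); last first.
  by case: (below_prod_nat_small k x xinf le).
apply: (card_le_trans (cf_least [set: k] _)) => [y|].
  by exists y => //; exact: cle_refl.
apply: (card_le_trans le).
have /countable_injP[e einj] := finite_set_countable xfin.
apply: (injective_on_card_le _ _ (fun p => pickle (e p.1, p.2))) => //.
move=> [y n] [z m] /= [yx _] [zx _] /(pcan_inj pickleK)[eyz ->].
by congr pair; apply: einj => //; exact: mem_set.
Qed.

(** A countable cofinal set cuts [k] into countably many pieces, each bounded by
    one of its points and hence small. *)
Lemma indecomposable_cf_uncountable (k : cardinal) :
  CN k -> countably_indecomposable [set: k] -> omega <c cf k.
Proof.
move=> kinf indec.
suff cfN : ~ (cf k <=c omega).
  by split=> //; have [|/cfN] := cardinal_le_total omega (cf k).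
rewrite (card_le_eqr (card_ofP nat)) => cfle.
have [[S Scof Scf] _] := cfP k.
have /countable_injP[e einj] : S #<= [set: nat] by rewrite (card_le_eql Scf).
have /choice[r rP] : forall x, exists y, S y /\ cle x y.
  by move=> x; have [y] := Scof x; exists y.
have [n] := indec (e \o r); rewrite setTI => le.
have [a _] := infinite_setN0 kinf.
have [b /= bn] : (e \o r) @^-1` [set n] !=set0.
  apply/set0P/negP => /eqP E; move: le; rewrite E => /card_le0P.
  by move=> /seteqP[/(_ a I)].
apply: (cle_segment_small k kinf (r b)); apply: (card_le_trans le).
apply: subset_card_le => x /= xn; have [Srx xr] := rP x.
suff -> : r b = r x by [].
by apply: einj; rewrite ?bn ?xn //; apply: mem_set => //; exact: (rP b).1.
Qed.

(** Konig's diagonal argument.  As [T] absorbs a factor nat, an element of the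
    power set of [T] is a sequence of such elements.  If every piece were
    small, the n-th coordinate of the points in the n-th piece would always
    miss some value [y n]; the point with coordinates [y] is then in no
    piece. *)
Lemma power_indecomposable (T : Type) :
  infinite_set [set: T] -> countably_indecomposable [set: T -> bool].
Proof.
move=> /infinite_prod_nat_card_le le d.
have [[t0]|T0] := pselect (exists t : T, True); last first.
  exists (d (fun=> true)); apply: subset_card_le => f _; split=> //=; congr d.
  by apply/funext => t; case: T0; exists t.
move=> _; have [c _ cinj] := card_le_injective_on _ _ (ex_intro _ t0 I) le.
have Gsurj (y : nat -> T -> bool) :
    exists w, forall n t, w (c (t, n)) = y n t.
  exists (fun s => `[< exists n t, c (t, n) = s /\ y n t >]) => n t.
  apply/asboolP/idP => [[m [u [/(cinj _ _ I I)[-> ->]]]]//|ynt].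
  by exists n, t.
apply: contrapT => /forallNP small.
have /choice[y yP] : forall n, exists z : T -> bool,
    forall w, d w = n -> (fun t => w (c (t, n))) <> z.
  move=> n; apply: contrapT => /forallNP all; apply: (small n).
  apply: (card_le_trans _ (card_image_le (fun w t => w (c (t, n))) _)).
  apply: subset_card_le => z _; rewrite setTI.
  by have /existsNP[w /not_implyP[dw /contrapT <-]] := all z; exists w.
have [w wy] := Gsurj y; apply: (yP (d w) w) => //.
by apply/funext => t; exact: wy.
Qed.

(** * The continuum as the number of sets of integers *)

Section RealCodes.
Local Open Scope ring_scope.
Variable R : realType.

(** A real is determined by the rationals below it. *)
Lemma real_card_le_set_nat : [set: R] #<= [set: set nat].
Proof.
pose cut (x : R) : set nat :=
  [set n | exists q : rat, pickle q = n /\ ratr q < x].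
have cut_lt x y : x < y -> cut x <> cut y.
  move=> /rat_in_itvoo[q]; rewrite in_itv /= => /andP[xq qy] exy.
  have : cut y (pickle q) by exists q.
  rewrite -exy => -[p [/(pcan_inj pickleK) -> qx]].
  by have := lt_trans xq qx; rewrite ltxx.
apply: (injective_card_le cut) => x y exy.
by have [/cut_lt|/cut_lt /nesym|] := ltgtP x y.
Qed.

(** Partial sums of the ternary expansion with digit 1 at the places in [A]. *)
Definition ternary (A : set nat) (n : nat) : R :=
  \sum_(i < n) (if `[< A i >] then 3^-1 ^+ i else 0).

Definition ternary_real (A : set nat) : R := sup (range (ternary A)).

Lemma ternaryS A n :
  ternary A n.+1 = ternary A n + (if `[< A n >] then 3^-1 ^+ n else 0).
Proof. by rewrite /ternary big_ord_recr. Qed.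

(** The geometric tail from place [m] on sums to [3/2 * 3^-m]. *)
Lemma ternary_le A m n : ternary A n <= ternary A m + 3 / 2 * 3^-1 ^+ m.
Proof.
have pos i : (0 : R) < 3^-1 ^+ i by rewrite exprn_gt0 // invr_gt0 ltr0n.
have up i : ternary A i <= ternary A i.+1.
  by rewrite ternaryS lerDl; case: ifP => // _; exact: ltW.
have down i : ternary A i.+1 + 3 / 2 * 3^-1 ^+ i.+1 <=
              ternary A i + 3 / 2 * 3^-1 ^+ i.
  rewrite ternaryS exprS; have := pos i; set p := _ ^+ i; case: ifP => _; lra.
have [mn|nm] := leqP m n.
  have {}down i : ternary A (m + i) + 3 / 2 * 3^-1 ^+ (m + i) <=
                ternary A m + 3 / 2 * 3^-1 ^+ m.
    by elim: i => [|i IH]; rewrite ?addn0 // addnS (le_trans (down _)).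
  have := down (n - m)%N; rewrite subnKC //; apply: le_trans.
  by rewrite lerDl; have := pos n; lra.
have {}up i : ternary A n <= ternary A (n + i).
  by elim: i => [|i IH]; rewrite ?addn0 // addnS (le_trans IH).
have := up (m - n)%N; rewrite subnKC 1?ltnW // => /le_trans; apply.
by rewrite lerDl; have := pos m; lra.
Qed.

Lemma ternary_real_ge A n : ternary A n <= ternary_real A.
Proof.
apply: ub_le_sup; last by exists n.
by exists (ternary A 0 + 3 / 2 * 3^-1 ^+ 0) => _ [m _ <-]; exact: ternary_le.
Qed.

Lemma ternary_real_le A m : ternary_real A <= ternary A m + 3 / 2 * 3^-1 ^+ m.
Proof.
apply: ge_sup; first by exists (ternary A 0), 0.
by move=> _ [n _ <-]; exact: ternary_le.
Qed.

(** The first differing digit decides the order: it contributes [3^-n] on one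
    side, while everything after it amounts to at most half of that on the
    other. *)
Lemma ternary_real_lt (A B : set nat) n :
  (forall i, (i < n)%N -> A i <-> B i) -> A n -> ~ B n ->
  ternary_real B < ternary_real A.
Proof.
move=> eqAB An nBn.
have e : ternary A n = ternary B n.
  apply: eq_bigr => i _.
  by have /propext -> := eqAB i (ltn_ord i).
have := ternary_real_ge A n.+1; have := ternary_real_le B n.+1.
rewrite !ternaryS e (asboolT An) (asboolF nBn) exprS.
have : (0 : R) < 3^-1 ^+ n by rewrite exprn_gt0 // invr_gt0 ltr0n.
set p := _ ^+ n; lra.
Qed.

Lemma ternary_real_inj : injective ternary_real.
Proof.
move=> A B eAB; apply/funext => n; apply/propext.
elim/ltn_ind: n => n IH.
split=> [An|Bn]; apply: contrapT => nn.
  by have := ternary_real_lt A B n IH An nn; rewrite eAB ltxx.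
have IH' i : (i < n)%N -> B i <-> A i by move=> /IH[].
by have := ternary_real_lt B A n IH' Bn nn; rewrite eAB ltxx.
Qed.

End RealCodes.

Lemma continuum_set_nat : [set: continuum] #= [set: set nat].
Proof.
rewrite (card_eql (card_ofP _)) card_eq_le real_card_le_set_nat.
exact: injective_card_le (@ternary_real_inj Rdefinitions.R).
Qed.

(** * Calibers of separable spaces *)

Section CaliberInclusions.
Variable X : topologicalType.

Lemma common_point_centered (V : set (set X)) :
  \bigcap_(A in V) A !=set0 -> centered V.
Proof. by move=> [x Vx] F FV _ _; exists x => A /FV /Vx. Qed.

Lemma centered_linked (V : set (set X)) : centered V -> linked V.
Proof.
move=> cV A B VA VB; have [|||x ABx] := cV [set A; B].
- by move=> C [->|->].
- exact: finite_set2.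
- by exists A; left.
by exists x; split; apply: ABx; [left|right].
Qed.

Lemma calibers_sub_precalibers : calibers X `<=` precalibers X.
Proof.
move=> k [kinf kcal]; split=> // U Uop; have [J [Jk [x Jx]]] := kcal U Uop.
exists J; split=> //; apply: common_point_centered.
by exists x => _ [a Ja <-]; exact: Jx.
Qed.

Lemma precalibers_sub_weak_precalibers : precalibers X `<=` weak_precalibers X.
Proof.
move=> k [kinf kpre]; split=> // U Uop; have [J [Jk cJ]] := kpre U Uop.
by exists J; split=> //; exact: centered_linked.
Qed.

Lemma calibers_star_sub_precalibers_star :
  calibers_star X `<=` precalibers_star X.
Proof.
move=> k [kinf kcal]; split=> // U Uop Uk; have [V [VU Vk Vx]] := kcal U Uop Uk.
by exists V; split=> //; exact: common_point_centered.
Qed.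

Variable x : nat -> X.
Hypothesis x_dense : forall O, @tau_plus X O -> exists n, O (x n).

Lemma separable_indecomposable_caliber (k : cardinal) :
  CN k -> countably_indecomposable [set: k] -> calibers X k.
Proof.
move=> kinf indec; split=> // U Uop.
have /choice[d dP] : forall a, exists n, U a (x n) by move=> a; exact: x_dense.
have [n] := indec d; rewrite setTI => le.
exists (d @^-1` [set n]); split; first by rewrite card_eq_le card_leT.
by exists (x n) => a <-; exact: dP.
Qed.

Lemma separable_indecomposable_common_point (U : set (set X)) :
  U `<=` @tau_plus X -> countably_indecomposable U ->
  exists V, [/\ V `<=` U, V #= U & \bigcap_(A in V) A !=set0].
Proof.
move=> Uop indec.
have /choice[d dP] : forall A, exists n, U A -> A (x n).
  move=> A; have [/Uop/x_dense[n An]|] := pselect (U A); first by exists n.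
  by exists 0.
have [n le] := indec d; exists (U `&` d @^-1` [set n]); split.
- by move=> A [].
- by rewrite card_eq_le le andbT subset_card_le // => A [].
- by exists (x n) => A [UA <-]; exact: dP.
Qed.

End CaliberInclusions.

(** * The space beta omega *)

Definition principal (n : nat) : beta_omega :=
  @BetaOmega _ (principal_filter_ultra n).

Lemma principal_beta_base (A : set nat) (n : nat) :
  beta_base A (principal n) <-> A n.
Proof. exact: principal_filterP. Qed.

Lemma beta_base_meet (A B : set nat) :
  beta_base A `&` beta_base B !=set0 -> A `&` B !=set0.
Proof.
move=> [u [uA uB]]; have [uproper _] := ultra_setsP u.
exact: (@filter_ex _ _ uproper _ (@filterI _ _ (ultra_filter u) _ _ uA uB)).
Qed.

Lemma beta_base_inj : injective beta_base.
Proof.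
move=> A B eAB; apply/seteqP; split=> n /principal_beta_base.
  by rewrite eAB => /principal_beta_base.
by rewrite -eAB => /principal_beta_base.
Qed.

Lemma beta_base_tau_plus (A : set nat) : A !=set0 -> tau_plus (beta_base A).
Proof.
move=> [n An]; split; last by exists (principal n); apply/principal_beta_base.
by apply/beta_openE; exists [set A] => //; rewrite bigcup_set1.
Qed.

Lemma principal_dense (O : set beta_omega) :
  tau_plus O -> exists n, O (principal n).
Proof.
move=> [/beta_openE[D _ <-] [u [A DA uA]]].
have [|n [An _]] := beta_base_meet A A; first by exists u.
by exists n, A => //; apply/principal_beta_base.
Qed.

(** An open set is determined by the basic clopen sets it contains, that is by a
    set of subsets of nat. *)
Lemma tau_plus_card_le : @tau_plus beta_omega #<= [set: cpow2 continuum].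
Proof.
rewrite (card_le_eqr (card_ofP _)).
have le : [set: set nat] #<= [set: continuum].
  by rewrite (card_le_eqr continuum_set_nat).
have [r0 _] : [set: continuum] !=set0.
  apply/set0P/negP => /eqP E; move: le; rewrite E => /card_le0P.
  by move=> /seteqP[/(_ set0 I)].
have [h _ hinj] := card_le_injective_on _ _ (ex_intro _ r0 I) le.
pose code (O : set beta_omega) r := `[< exists2 A, beta_base A `<=` O & h A = r >].
apply: (injective_on_card_le _ _ code) => //.
suff sub O O' : tau_plus O -> code O = code O' -> O `<=` O'.
  by move=> O O' Oop O'op e; apply/seteqP; split; exact: sub.
move=> [/beta_openE[D _ <-] _] e u [A DA uA].
have : code O' (h A).
  by rewrite -e; apply/asboolP; exists A => // v vA; exists A.
move=> /asboolP[B BO' hBA].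
by apply: BO'; rewrite (hinj B A I I hBA).
Qed.

Lemma continuum_infinite : infinite_set [set: continuum].
Proof.
apply/infiniteP; rewrite (card_le_eqr continuum_set_nat).
by apply: (injective_card_le (fun n : nat => [set n])) => m n /seteqP[/(_ m erefl)].
Qed.

Lemma cpow2_continuum_indecomposable :
  countably_indecomposable [set: cpow2 continuum].
Proof.
apply: countably_indecomposable_eq (power_indecomposable _ continuum_infinite).
by rewrite card_eq_sym; exact: card_ofP.
Qed.

Lemma cf_uncountable_calibers (k : cardinal) :
  CN k -> omega <c cf k -> calibers beta_omega k.
Proof.
move=> kinf kcf.
apply: (separable_indecomposable_caliber _ _ principal_dense) => //.
exact: cf_uncountable_indecomposable.
Qed.

(** Singletons turn a decomposition [d] of [k] into open sets that meet only when
    they belong to the same piece. *)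
Lemma weak_precalibers_cf_uncountable (k : cardinal) :
  weak_precalibers beta_omega k -> omega <c cf k.
Proof.
move=> [kinf kwp]; apply: indecomposable_cf_uncountable => // d.
have [a|J [Jk Jlinked]] := kwp (fun a => beta_base [set d a]).
  by apply: beta_base_tau_plus; exists (d a).
have [b Jb] : J !=set0.
  by apply: infinite_setN0; rewrite (eq_finite_set Jk).
exists (d b); rewrite setTI -(card_le_eql Jk); apply: subset_card_le => a Ja /=.
have [|n [<- <-//]] := beta_base_meet [set d a] [set d b].
by apply: Jlinked; [exists a|exists b].
Qed.

(** As for weak precalibers, but with pairwise distinct open sets: the integer
    coding [(n, j)] lies in column [n], and an embedding [g] of [k] into the
    subsets of nat selects for each [a] its own subset of column [d a]. *)
Lemma precalibers_star_cf_uncountable (k : cardinal) :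
  precalibers_star beta_omega k -> k <=c continuum -> omega <c cf k.
Proof.
move=> [kinf kpre] kle; apply: indecomposable_cf_uncountable => // d.
have kle2 : [set: k] #<= [set: set nat].
  by rewrite -(card_le_eqr continuum_set_nat).
have [g _ ginj] := card_le_injective_on _ _ (ex_intro _ (set0 : set nat) I) kle2.
(* The entry [None] keeps [S a] non-empty even when [g a] is empty. *)
pose S a : set nat := [set m | exists2 j : option nat, pickle (d a, j) = m &
  if j is Some i then g a i else True].
have SN0 a : S a (pickle (d a, None : option nat)) by exists None.
have Sd a b : S a `&` S b !=set0 -> d a = d b.
  by move=> [_ [[j <- _] [j' /(pcan_inj pickleK)[-> _] _]]].
have Ssub a b : S a = S b -> g a `<=` g b.
  move=> e i gai; have : S a (pickle (d a, Some i)) by exists (Some i).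
  by rewrite e => -[j /(pcan_inj pickleK)[_ ->]].
have Sinj : injective S.
  move=> a b e; apply: ginj => //; apply/seteqP.
  by split; apply: Ssub.
have Uinj : injective (beta_base \o S) by move=> a b /beta_base_inj /Sinj.
have UE A : A #= (beta_base \o S) @` A.
  by rewrite card_eq_sym; apply: inj_card_eq; exact: in2W.
have [||V [VU Vk /centered_linked Vlinked]] := kpre (range (beta_base \o S)).
- move=> _ [a _ <-]; apply: beta_base_tau_plus.
  by exists (pickle (d a, None : option nat)).
- by rewrite card_eq_sym; exact: UE.
have [W0 VW0] : V !=set0 by apply: infinite_setN0; rewrite (eq_finite_set Vk).
have [b _ /= Sb] := VU _ VW0; exists (d b).
rewrite setTI -(card_le_eql Vk) (card_le_eqr (UE _)).
apply: subset_card_le => W VW; have [a _ /= Sa] := VU _ VW; exists a => //=.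
by apply/Sd/beta_base_meet; rewrite Sa Sb; exact: Vlinked.
Qed.

(** * Calibers of beta omega *)

Theorem theorem3p27 :
  (calibers beta_omega = precalibers beta_omega /\
   precalibers beta_omega = weak_precalibers beta_omega /\
   weak_precalibers beta_omega = [set k | CN k /\ omega <c cf k]) /\
  ([set k | CN k /\ omega <c cf k] `|` [set k | CN k /\ cpow2 continuum <=c k]
     `<=` calibers_star beta_omega) /\
  (precalibers_star beta_omega `<=`
     [set k | CN k /\ omega <c cf k] `|`
     [set k | CN k /\ (cf k =c omega /\ continuum <c k)]) /\
  (cpow2 continuum =c csucc continuum ->
   calibers_star beta_omega = precalibers_star beta_omega /\
   precalibers_star beta_omega =
     [set k | CN k /\ cpow2 continuum <=c k] `|`
     [set k | CN k /\ (k <c cpow2 continuum /\ omega <c cf k)]).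
Proof.
have CP := @calibers_sub_precalibers beta_omega.
have PW := @precalibers_sub_weak_precalibers beta_omega.
have WK : weak_precalibers beta_omega `<=` [set k | CN k /\ omega <c cf k].
  by move=> k kW; split; [exact: kW.1|exact: weak_precalibers_cf_uncountable].
have KC : [set k | CN k /\ omega <c cf k] `<=` calibers beta_omega.
  by move=> k [kinf kcf]; exact: cf_uncountable_calibers.
have K2C : [set k | CN k /\ omega <c cf k] `|`
    [set k | CN k /\ cpow2 continuum <=c k] `<=` calibers_star beta_omega.
  move=> k kK; have kinf : CN k by case: kK => [][].
  split=> // U Uop Uk.
  suff indec : countably_indecomposable U.
    have [V [VU VU' Vx]] :=
      separable_indecomposable_common_point _ _ principal_dense U Uop indec.
    by exists V; split=> //; exact: card_eq_trans VU' Uk.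
  case: kK => [[_ kcf]|[_ ck]].
    apply: (countably_indecomposable_eq _ _ (card_esym Uk)).
    exact: cf_uncountable_indecomposable.
  apply: countably_indecomposable_eq cpow2_continuum_indecomposable.
  rewrite card_eq_le (card_le_eqr Uk) ck /=.
  exact: (card_le_trans (subset_card_le Uop) tau_plus_card_le).
have P2K : precalibers_star beta_omega `<=` [set k | CN k /\ omega <c cf k] `|`
     [set k | CN k /\ (cf k =c omega /\ continuum <c k)].
  move=> k kP; have kinf := kP.1.
  have [kcf|kcf] := pselect (omega <c cf k); [by left|right; split=> //; split].
    rewrite card_eq_le; apply/andP; split.
      have [//|?] := cardinal_le_total (cf k) omega.
      by apply: contrapT => ?; apply: kcf.
    rewrite (card_le_eql (card_ofP nat)); apply/infiniteP.
    exact: cf_infinite.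
  have kc : ~ k <=c continuum by move=> /(precalibers_star_cf_uncountable _ kP).
  by split=> //; have [|/kc] := cardinal_le_total continuum k.
split.
  have PK := subset_trans PW WK.
  split; first by apply/seteqP; split=> // k /PK/KC.
  split; first by apply/seteqP; split=> // k /WK/KC/CP.
  by apply/seteqP; split=> // k /KC/CP/PW.
split=> //; split=> // cont.
set K := _ `|` _.
have KC2 : K `<=` calibers_star beta_omega.
  by move=> k [[kinf ck]|[kinf [_ kcf]]]; apply: K2C; [right|left].
have C2P2 := @calibers_star_sub_precalibers_star beta_omega.
have P2K' : precalibers_star beta_omega `<=` K.
  move=> k /P2K[[kinf kcf]|[kinf [_ ck]]]; last first.
    by left; split=> //; rewrite (card_le_eql cont); exact: (csuccP continuum).2.
  have [ck|ck] := pselect (cpow2 continuum <=c k); [by left|right].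
  by split=> //; split=> //; have [//|/ck] := cardinal_le_total k (cpow2 continuum).
by split; apply/seteqP; split=> // k; [move=> /P2K'/KC2|move=> /KC2/C2P2].
Qed.
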